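(* Let $K$ be a field and $S=K[x_1,\ldots,x_n]$. Let $I\subset S$ be a complete intersection monomial ideal. Then $\operatorname{sdepth}(I)=\operatorname{sdepth}(\sqrt{I})$.
   Context: Let $I$ be a nonzero monomial ideal of a polynomial ring $S=K[x_1,\ldots,x_n]$ over a field $K$. For a monomial $u\in S$ and a subset $Z\subset\{x_1,\ldots,x_n\}$, $uK[Z]$ denotes the $K$-subspace of $S$ spanned by all monomials $uw$ with $w$ a monomial in the variables of $Z$. A Stanley decomposition of $I$ is a finite direct sum decomposition of $K$-vector spaces $\mathcal D: I=\bigoplus_{i=1}^r u_iK[Z_i]$ with $u_i\in S$ monomials and $Z_i\subset\{x_1,\ldots,x_n\}$. Put $\operatorname{sdepth}(\mathcal D)=\min_{1\le i\le r}|Z_i|$. The Stanley depth of $I$ is $\operatorname{sdepth}(I)=\max\{\operatorname{sdepth}(\mathcal D) : \mathcal D \text{ is a Stanley decomposition of } I\}$. A complete intersection monomial ideal is a nonzero proper monomial ideal $I\subset S$ whose minimal monomial generators $v_1,\ldots,v_m$ form a regular sequence in $S$ (equivalently, they are monomials different from $1$ with pairwise disjoint supports, the support of a monomial being the set of variables dividing it). $\sqrt I$ is the radical of $I$. *)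

(* Defs.v *)
From mathcomp Require Import all_boot all_algebra.
From mathcomp Require Import mpoly.
From mathcomp Require Import boolp classical_sets.

Set Implicit Arguments.
Unset Strict Implicit.
Unset Printing Implicit Defensive.

Import GRing.Theory.

Local Open Scope classical_set_scope.
Local Open Scope ring_scope.

(* An ideal of a commutative ring is a submodule of the regular module. The
   library's [idealr_closed] is not used because it also requires the ideal to
   be proper. *)
Definition is_ideal (R : comNzRingType) (I : set R) : Prop :=
  submod_closed (mem I : {pred R^o}).

Definition ideal_gen (R : comNzRingType) (G : set R) : set R :=
  smallest (@is_ideal R) G.

Definition radical (R : comNzRingType) (I : set R) : set R :=
  [set f | exists k : nat, I (f ^+ k.+1)].

Definition regular_sequence (R : comNzRingType) (s : seq R) : Prop :=
  (forall i : nat, (i < size s)%N -> forall f : R,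
     ideal_gen [set` take i s] (s`_i * f) -> ideal_gen [set` take i s] f) /\
  ideal_gen [set` s] <> setT.

Definition is_subspace (K : fieldType) (V : lmodType K) (W : set V) : Prop :=
  submod_closed (mem W).

Definition lspan (K : fieldType) (V : lmodType K) (G : set V) : set V :=
  smallest (@is_subspace K V) G.

Definition direct_sum (K : fieldType) (V : lmodType K) (W : set V) (r : nat)
    (U : 'I_r -> set V) : Prop :=
  W = [set \sum_(i < r) f i | f in [set f : 'I_r -> V | forall i, U i (f i)]] /\
  (forall f : 'I_r -> V, (forall i, U i (f i)) ->
     \sum_(i < r) f i = 0 -> forall i, f i = 0).

Section MonomialIdeals.
Variables (K : fieldType) (n : nat).
Implicit Types (I : set {mpoly K[n]}) (v : seq 'X_{1..n}).

Definition monomial_ideal I : Prop :=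
  exists A : set 'X_{1..n}, I = ideal_gen [set 'X_[a] | a in A].

Definition monomials v : seq {mpoly K[n]} := [seq 'X_[m] | m <- v].

Definition generates v I : Prop := I = ideal_gen [set` monomials v].

Definition minimal_generators v I : Prop :=
  generates v I /\
  (forall v' : seq 'X_{1..n}, subseq v' v -> generates v' I -> v' = v).

Definition complete_intersection_monomial_ideal I : Prop :=
  [/\ monomial_ideal I, I <> [set 0], I <> setT &
      exists v, minimal_generators v I /\ regular_sequence (monomials v)].

Definition stanley_space (u : 'X_{1..n}) (Z : {set 'I_n}) : set {mpoly K[n]} :=
  lspan [set 'X_[u] * 'X_[w] | w in
          [set w : 'X_{1..n} | forall j, j \notin Z -> w j = 0%N]].

Definition stanley_decomposition I (r : nat) (u : 'I_r -> 'X_{1..n})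
    (Z : 'I_r -> {set 'I_n}) : Prop :=
  direct_sum I (fun i => stanley_space (u i) (Z i)).

(* Since #|Z i| <= n, the neutral element n only matters when r = 0, that is,
   for the zero ideal. *)
Definition decomposition_sdepth (r : nat) (Z : 'I_r -> {set 'I_n}) : nat :=
  \big[minn/n]_(i < r) #|Z i|.

(* The depths of Stanley decompositions are bounded by n, so this is their
   maximum as soon as I has a Stanley decomposition, which is the case for
   monomial ideals. *)
Definition sdepth I : nat :=
  \max_(d < n.+1 | `[< exists r (u : 'I_r -> 'X_{1..n}) (Z : 'I_r -> {set 'I_n}),
                         stanley_decomposition I u Z /\
                         decomposition_sdepth Z = d >]) d.

End MonomialIdeals.

(* Main.v *)
Require Import Defs.
From mathcomp Require Import all_boot all_algebra.
From mathcomp Require Import mpoly.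
From mathcomp Require Import boolp classical_sets.

(* Everything happens on exponent vectors: a Stanley decomposition of a monomial
   ideal is a partition of its monomials into cells [u + N^Z].  Let [phi] act
   coordinatewise on exponents, each [phi j] monotone and unbounded, that is,
   having a left adjoint [psi j].  Then the preimage under [phi] of a cell in
   directions [Z] is a finite disjoint union of cells in the same directions,
   so pulling back along [phi] never decreases the Stanley depth.  The monomials
   of [sqrt I] are the preimage of those of [I] under [m |-> N m] for [N] large;
   conversely, if [a j] is the exponent of [x_j] in the only generator that it
   divides, the monomials of [I] are the preimage of those of [sqrt I] under
   [m j |-> m j - (a j - 1)] (truncated subtraction). *)

Set Implicit Arguments.
Unset Strict Implicit.
Unset Printing Implicit Defensive.

Import GRing.Theory.

Local Open Scope classical_set_scope.
Local Open Scope ring_scope.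

(** * Submodules given as sets *)

Section Submodules.
Variables (R : pzRingType) (V : lmodType R) (W : set V).
Hypothesis closedW : submod_closed (mem W).

Lemma submod_set0 : W 0.
Proof. by case: closedW; rewrite in_setE. Qed.

Lemma submod_setD (u v : V) : W u -> W v -> W (u + v).
Proof.
move=> Wu Wv; case: closedW => _ /(_ 1 u v).
by rewrite scale1r !in_setE; apply.
Qed.

Lemma submod_setZ (a : R) (u : V) : W u -> W (a *: u).
Proof.
move=> Wu; case: closedW => W0 /(_ a u 0).
by rewrite addr0 !in_setE; apply; rewrite // -in_setE.
Qed.

Lemma submod_set_sum (I : eqType) (s : seq I) (F : I -> V) :
  (forall i, i \in s -> W (F i)) -> W (\sum_(i <- s) F i).
Proof.
move=> WF; rewrite big_seq; elim/big_rec: _ => [|i v si Wv].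
  exact: submod_set0.
by apply: submod_setD => //; apply: WF.
Qed.

End Submodules.

Section Smallest.
Variables (R : pzRingType) (V : lmodType R) (G : set V).

Lemma submod_smallest :
  submod_closed (mem (smallest (fun W : set V => submod_closed (mem W)) G)).
Proof.
split=> [|a u v].
  by rewrite in_setE => W [cW _]; apply: submod_set0.
rewrite !in_setE => Gu Gv W [cW GW].
apply: submod_setD => //; last exact: Gv.
by apply: submod_setZ => //; apply: Gu.
Qed.

End Smallest.

(** * Ideals and radicals *)

Section Ideals.
Variable R : comNzRingType.
Implicit Types I G : set R.

Lemma idealM I (a b : R) : is_ideal I -> I b -> I (a * b).
Proof. by move=> cI Ib; apply: (submod_setZ (V := R^o)). Qed.

Lemma is_ideal_gen G : is_ideal (ideal_gen G).
Proof. exact: (submod_smallest (V := R^o)). Qed.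

Lemma ideal_gen1 G : ideal_gen G 1 -> ideal_gen G = setT.
Proof.
move=> G1; rewrite eqEsubset; split=> // a _.
by rewrite -[a]mulr1; apply: idealM G1; apply: is_ideal_gen.
Qed.

Lemma is_ideal_radical I : is_ideal I -> is_ideal (radical I).
Proof.
move=> cI; split=> [|a u v].
  by rewrite in_setE; exists 0; rewrite expr1; apply: submod_set0 cI.
rewrite !in_setE => -[k Iu] [l Iv]; exists (k + l)%N.
have IX b p i : I (b ^+ p.+1) -> (p < i)%N -> I (b ^+ i).
  by move=> Ib pi; rewrite -(subnK pi) exprD; apply: idealM.
(* In each term of this expansion of degree [k + l + 1], either the exponent of [v] exceeds [l] or
   that of [a *: u] exceeds [k]. *)
rewrite exprDn; apply: (submod_set_sum cI) => i _.
rewrite -mulr_natl; apply: idealM => //.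
have [li|li] := ltnP l i.
  by apply: idealM => //; apply: IX Iv li.
rewrite mulrC exprMn; do 2!apply: idealM => //; apply: IX Iu _.
by rewrite ltn_subRL addnC ltnS leq_add2l.
Qed.

End Ideals.

(** * Spans of monomials, monomial ideals and their radicals *)

Section MonomialSpan.
Variables (K : fieldType) (n : nat).
Implicit Types (P Q A : set 'X_{1..n}) (f g : {mpoly K[n]}) (m : 'X_{1..n}).

(** Defined through supports rather than generators, so that membership is tested coefficient by
    coefficient. *)
Definition monomial_span P : set {mpoly K[n]} :=
  [set f | forall m, m \in msupp f -> P m].

Definition upward_closed P : Prop :=
  forall m m', (m <= m')%MM -> P m -> P m'.

Definition multiples A : set 'X_{1..n} :=
  [set m | exists2 a, A a & (a <= m)%MM].

Definition restrict P f : {mpoly K[n]} :=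
  \sum_(m <- msupp f | `[< P m >]) f@_m *: 'X_[m].

Lemma mcoeff_restrict P f m :
  (restrict P f)@_m = if `[< P m >] then f@_m else 0.
Proof.
rewrite /restrict raddf_sum /=.
under eq_bigr do rewrite mcoeffZ mcoeffX.
have [mf|mf] := boolP (m \in msupp f); last first.
  rewrite big1_seq ?(memN_msupp_eq0 mf) ?if_same // => m' /andP[_ m'f].
  by case: eqP => [e|]; rewrite ?mulr0 // -e m'f in mf *.
case: asboolP => Pm; last first.
  rewrite big1_seq // => m' /andP[/asboolP Pm' _].
  by case: eqP => [e|]; rewrite ?mulr0 // -e in Pm *.
rewrite -big_filter (bigD1_seq m) ?filter_uniq //=; last first.
  by rewrite mem_filter mf andbT; apply/asboolP.
rewrite eqxx mulr1 big1 ?addr0 // => m' /negbTE ne.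
by rewrite ne mulr0.
Qed.

Lemma restrict_span P f : monomial_span P (restrict P f).
Proof.
move=> m; rewrite mcoeff_msupp mcoeff_restrict.
by case: asboolP => //; rewrite eqxx.
Qed.

Lemma monomial_spanX P m : monomial_span P 'X_[m] <-> P m.
Proof.
split=> [|Pm m' /mem_msuppXP <- //]; apply.
exact/mem_msuppXP.
Qed.

Lemma submod_monomial_span P : is_subspace (monomial_span P).
Proof.
split=> [|a f g]; first by rewrite in_setE => m; rewrite msupp0.
rewrite !in_setE => Pf Pg m.
move/msuppD_le; rewrite mem_cat => /orP[/msuppZ_le /Pf|/Pg] //.
Qed.

Lemma ideal_monomial_span P : upward_closed P -> is_ideal (monomial_span P).
Proof.
move=> upP; split=> [|a f g]; first by rewrite in_setE => m; rewrite msupp0.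
rewrite !in_setE => Pf Pg m.
move/msuppD_le; rewrite mem_cat => /orP[/msuppM_le|/Pg] //.
case/allpairsP=> -[m1 m2] /= [_ /Pf Pm2 ->].
exact: upP (lem_addl _ _) Pm2.
Qed.

Lemma monomial_span_sub (W : set {mpoly K[n]}) P : is_subspace W ->
  (forall m, P m -> W 'X_[m]) -> monomial_span P `<=` W.
Proof.
move=> cW WX f Pf; rewrite (mpolyE f).
by apply: submod_set_sum => // m /Pf/WX; apply: submod_setZ.
Qed.

Lemma lspan_monomials P : lspan [set 'X_[m] | m in P] = monomial_span P.
Proof.
rewrite eqEsubset; split.
  apply: smallest_sub; first exact: submod_monomial_span.
  by move=> _ [m Pm <-]; apply/monomial_spanX.
apply: monomial_span_sub; first exact: submod_smallest.
by move=> m Pm; apply: sub_gen_smallest; exists m.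
Qed.

Lemma is_subspace_ideal (J : set {mpoly K[n]}) : is_ideal J -> is_subspace J.
Proof.
move=> cJ; split=> [|a f g]; first by rewrite in_setE; apply: submod_set0 cJ.
rewrite !in_setE => Jf Jg; rewrite -mul_mpolyC.
by apply: (submod_setD cJ) => //; apply: idealM.
Qed.

Lemma upward_closed_multiples A : upward_closed (multiples A).
Proof.
by move=> m m' le_mm' [a Aa le_am]; exists a => //; apply: lepm_trans le_mm'.
Qed.

Lemma ideal_gen_monomials A :
  ideal_gen [set 'X_[a] | a in A] = monomial_span (multiples A).
Proof.
rewrite eqEsubset; split.
  apply: smallest_sub.
    by apply: ideal_monomial_span; apply: upward_closed_multiples.
  by move=> _ [a Aa <-]; apply/monomial_spanX; exists a => //; apply: lepm_refl.
apply: monomial_span_sub; first exact/is_subspace_ideal/is_ideal_gen.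
move=> m [a Aa le_am]; rewrite -(submK le_am) mpolyXD.
apply: (idealM _ (@is_ideal_gen _ _)).
by apply: sub_gen_smallest; exists a.
Qed.

(* [f ^+ k.+1 - (f - g) ^+ k.+1] is a multiple of [g], so only the part
   [f - g] of [f] outside the candidate radical matters, and its leading
   monomial would lie in the radical. *)
Lemma radical_monomial_span P : upward_closed P ->
  radical (monomial_span P) =
  monomial_span [set m | exists k, P (m *+ k.+1)%MM].
Proof.
move=> upP; set Q := [set m | _].
have le_mulm m m' k : (m <= m')%MM -> (m *+ k <= m' *+ k)%MM.
  move=> /mnm_lepP le; apply/mnm_lepP => i.
  by rewrite !mulmnE leq_mul2r le orbT.
have upQ : upward_closed Q.
  by move=> m m' le [k Pk]; exists k; apply: upP Pk; apply: le_mulm.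
have cP := ideal_monomial_span upP; have cQ := ideal_monomial_span upQ.
have cQ' := submod_monomial_span Q.
rewrite eqEsubset; split; last first.
  apply: monomial_span_sub; first exact/is_subspace_ideal/is_ideal_radical.
  by move=> m [k Pk]; exists k; rewrite mpolyXn; apply/monomial_spanX.
move=> f [k Pfk]; set g := restrict Q f; set h := f - g.
have hN m : m \in msupp h -> ~ Q m.
  rewrite mcoeff_msupp mcoeffB mcoeff_restrict.
  by case: asboolP; rewrite ?subrr ?eqxx.
suff h0 : h = 0.
  by move/eqP: h0; rewrite subr_eq0 => /eqP ->; apply: restrict_span.
apply/eqP/negPn/negP => h0; apply: (hN _ (mlead_supp h0)).
have Qhk : monomial_span Q (h ^+ k.+1).
  have -> : h ^+ k.+1 = f ^+ k.+1 + (h ^+ k.+1 - f ^+ k.+1) by rewrite subrKC.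
  apply: (submod_setD cQ).
    by move=> m /Pfk Pm; exists 0; rewrite mulm1n.
  rewrite subrXX mulrC; apply: (idealM _ cQ).
  have -> : h - f = -1 *: g by rewrite scaleN1r /h addrC addKr.
  by apply: (submod_setZ cQ'); apply: restrict_span.
have [|l] := Qhk (mlead (h ^+ k.+1)); first by rewrite mlead_supp // expf_neq0.
rewrite mleadX //.
have -> : (mlead h *+ k.+1 *+ l.+1 = mlead h *+ (k.+1 * l.+1).-1.+1)%MM.
  by apply/mnmP => i; rewrite !mulmnE -mulnA.
by exists (k.+1 * l.+1).-1.
Qed.

End MonomialSpan.

(** * Stanley decompositions as partitions of exponent vectors *)

Section Decompositions.
Variables (K : fieldType) (n : nat).
Implicit Types (P : set 'X_{1..n}) (u m : 'X_{1..n}) (Z : {set 'I_n}).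

Lemma direct_sum_monomial_span P (r : nat) (C : 'I_r -> set 'X_{1..n}) :
  direct_sum (@monomial_span K n P) (fun i => monomial_span (C i)) <->
  (forall m, P m <-> exists i, C i m) /\
  (forall i j m, C i m -> C j m -> i = j).
Proof.
split=> [[defP dirC]|[defP disjC]].
  split=> [m|i j m Cim Cjm].
    split=> [/(monomial_spanX K)|[i Cim]].
      (* The coefficients at [m] of the summands add up to 1, so some summand has [m] in its
         support. *)
      rewrite defP => -[f Cf] /(congr1 (mcoeff m)).
      rewrite mcoeffX eqxx raddf_sum /= => sum1.
      have [/existsP[i fi]|/existsPn f0] := boolP [exists i, m \in msupp (f i)].
        by exists i; apply: Cf fi.
      move/eqP: sum1; rewrite big1 ?(eq_sym 0) ?oner_eq0 // => i _.
      exact: memN_msupp_eq0.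
    apply/(monomial_spanX K); rewrite defP.
    exists (fun j => if j == i then 'X_[m] else 0).
      move=> j; case: eqP => [->|_]; first exact/monomial_spanX.
      exact: (submod_set0 (submod_monomial_span K _)).
    by rewrite -big_mkcond big_pred1_eq.
  (* A monomial common to two cells would give the nontrivial relation ['X_[m] - 'X_[m] = 0]. *)
  apply/eqP/negPn/negP => ne_ij.
  have ne_ji : j != i by rewrite eq_sym.
  pose f k : {mpoly K[n]} :=
    if k == i then 'X_[m] else if k == j then -1 *: 'X_[m] else 0.
  suff /(_ i)/eqP : forall k, f k = 0.
    by rewrite /f eqxx -msupp_eq0 msuppX.
  apply: dirC => [k|].
    rewrite /f; case: eqP => [->|_]; first exact/monomial_spanX.
    case: eqP => [->|_].
      by apply: (submod_setZ (submod_monomial_span K _)); apply/monomial_spanX.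
    exact: (submod_set0 (submod_monomial_span K _)).
  rewrite (bigD1 i) // (bigD1 j) //= big1 => [|k /andP[/negbTE ki /negbTE kj]].
    by rewrite /f eqxx (negbTE ne_ji) eqxx scaleN1r addr0 subrr.
  by rewrite /f ki kj.
rewrite /direct_sum eqEsubset; split; last first.
  move=> f Cf sum0 i; apply/mpolyP => m; rewrite mcoeff0.
  have [fim|/memN_msupp_eq0 //] := boolP (m \in msupp (f i)).
  have /(congr1 (mcoeff m)) := sum0; rewrite raddf_sum mcoeff0 (bigD1 i) //=.
  rewrite big1 ?addr0 // => j ne_ji; apply: memN_msupp_eq0.
  apply: contra ne_ji => fjm; apply/eqP.
  exact: disjC (Cf _ _ fjm) (Cf _ _ fim).
split=> [p Pp|_ [f Cf <-]]; last first.
  apply: submod_set_sum => [|i _]; first exact: submod_monomial_span.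
  by move=> m /Cf Cm; apply/defP; exists i.
(* The component of [p] in each summand is its part supported on that cell. *)
exists (fun i => restrict (C i) p) => [i|]; first exact: restrict_span.
apply/mpolyP => m; rewrite raddf_sum /=.
under eq_bigr do rewrite mcoeff_restrict.
have [/Pp/defP[i Ci]|/memN_msupp_eq0 ->] := boolP (m \in msupp p); last first.
  by rewrite big1 // => i _; rewrite if_same.
rewrite (bigD1 i) //= big1 ?addr0 => [|j /eqP ne]; first by case: asboolP.
by case: asboolP => // Cj; case: ne; apply: disjC Cj Ci.
Qed.

Definition stanley_cell u Z : set 'X_{1..n} :=
  [set m | (u <= m)%MM /\ forall j, j \notin Z -> m j = u j].

Lemma stanley_space_span u Z :
  @stanley_space K n u Z = monomial_span (stanley_cell u Z).
Proof.
rewrite -lspan_monomials; congr lspan; rewrite eqEsubset; split.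
  move=> _ [w wZ <-]; exists (u + w)%MM; last by rewrite mpolyXD.
  split=> [|j jZ]; first exact: lem_addr.
  by rewrite mnmDE wZ // addn0.
move=> _ [m [le_um mZ] <-]; exists (m - u)%MM.
  by move=> j jZ; rewrite mnmBE mZ // subnn.
by rewrite -mpolyXD addmC submK.
Qed.

Lemma stanley_decompositionE P (r : nat) (u : 'I_r -> 'X_{1..n})
    (Z : 'I_r -> {set 'I_n}) :
  stanley_decomposition (@monomial_span K n P) u Z <->
  (forall m, P m <-> exists i, stanley_cell (u i) (Z i) m) /\
  (forall i j m, stanley_cell (u i) (Z i) m -> stanley_cell (u j) (Z j) m ->
     i = j).
Proof.
rewrite -direct_sum_monomial_span /stanley_decomposition.
by under eq_fun do rewrite stanley_space_span.
Qed.

(** The conjunct [d <= n] accounts for the neutral element [n], the value of the empty minimum. *)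
Lemma leq_decomposition_sdepth (r : nat) (Z : 'I_r -> {set 'I_n}) d :
  (d <= decomposition_sdepth Z)%N = (d <= n)%N && [forall i, (d <= #|Z i|)%N].
Proof.
transitivity ((d <= n) && all (fun i => d <= #|Z i|) (index_enum 'I_r))%N.
  rewrite /decomposition_sdepth; elim: (index_enum _) => [|i s IHs] /=.
    by rewrite big_nil andbT.
  by rewrite big_cons leq_min IHs andbCA.
congr (_ && _); apply/allP/forallP => [leZ i|leZ i _] //.
by apply: leZ; rewrite mem_index_enum.
Qed.

Lemma sdepth_ge (J : set {mpoly K[n]}) (r : nat) (u : 'I_r -> 'X_{1..n})
    (Z : 'I_r -> {set 'I_n}) :
  stanley_decomposition J u Z -> (decomposition_sdepth Z <= sdepth J)%N.
Proof.
move=> dec; have lt_n : (decomposition_sdepth Z < n.+1)%N.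
  have := leqnn (decomposition_sdepth Z).
  by rewrite leq_decomposition_sdepth => /andP[].
rewrite /sdepth (bigmax_sup (Ordinal lt_n)) //.
by apply/asboolP; exists r, u, Z.
Qed.

(** * Pulling back cells along coordinatewise maps *)

Section Comap.
Variables phi psi : 'I_n -> nat -> nat.
Hypothesis galois : forall j c x, (psi j c <= x)%N = (c <= phi j x)%N.

Definition comap m : 'X_{1..n} := [multinom phi j (m j) | j < n].

Section Cells.
Variables (r : nat) (u : 'I_r -> 'X_{1..n}) (Z : 'I_r -> {set 'I_n}).

(* A coordinate [x] outside [Z i] of a monomial mapped into the [i]-th cell
   satisfies [phi j x = u i j], hence [x < psi j (u i j).+1]. *)
Definition corner_bound : nat := \max_(i < r) \max_(j < n) psi j (u i j).+1.

Definition is_corner (x : 'I_r * {ffun 'I_n -> 'I_corner_bound.+1}) : bool :=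
  [forall j, if j \in Z x.1 then x.2 j == psi j (u x.1 j) :> nat
             else phi j (x.2 j) == u x.1 j].

(* The preimage of the [i]-th cell is the disjoint union of the cells with
   directions [Z i] at the corners [(i, g)]. *)
Definition corner : finType := {x | is_corner x}.

Definition corner_u (x : corner) : 'X_{1..n} :=
  [multinom (val x).2 j : nat | j < n].

Definition corner_Z (x : corner) : {set 'I_n} := Z (val x).1.

Lemma leq_corner_bound i j x :
  (x <= psi j (u i j).+1)%N -> (x < corner_bound.+1)%N.
Proof.
move/leq_trans => le_x; rewrite ltnS; apply: le_x.
by apply: leq_trans (leq_bigmax i); apply: (leq_bigmax j).
Qed.

(** In a direction of [Z i], adjunction turns [u i j <= phi j (m j)] into [psi j (u i j) <= m j]. In
    any other direction [phi j (m j) = u i j], and the corner records which solution [m j] is. *)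
Lemma comap_cellP i m : stanley_cell (u i) (Z i) (comap m) <->
  exists2 x : corner, (val x).1 = i & stanley_cell (corner_u x) (corner_Z x) m.
Proof.
split=> [[/mnm_lepP le_um mZ]|[x <- [/mnm_lepP le_xm mZ]]]; last first.
  have /forallP corner_x := valP x.
  split=> [|j jZ]; last first.
    by have := corner_x j; rewrite mnmE mZ // mnmE (negbTE jZ) => /eqP.
  apply/mnm_lepP => j; have := corner_x j; rewrite mnmE.
  case: ifP => [_ /eqP x_j|/negbT jZ /eqP <-].
    by rewrite -galois -x_j; have := le_xm j; rewrite mnmE.
  by rewrite mZ // mnmE.
(* The corner of the cell containing [m]: least admissible value in the free directions, the
   coordinate of [m] in the others. *)
pose v j := if j \in Z i then psi j (u i j) else m j.
have v_bound j : (v j < corner_bound.+1)%N.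
  apply: (@leq_corner_bound i j); rewrite /v; case: ifP => [_|/negbT/mZ <-].
    by rewrite galois ltnW // -galois.
  by rewrite mnmE ltnW // ltnNge galois ltnn.
pose g : {ffun 'I_n -> 'I_corner_bound.+1} := [ffun j => inord (v j)].
have gE j : g j = v j :> nat by rewrite ffunE inordK.
have corner_g : is_corner (i, g).
  apply/forallP => j /=; rewrite gE /v; case: (boolP (j \in Z i)) => //= /mZ <-.
  by rewrite mnmE.
exists (exist _ (i, g) corner_g) => //; split=> [|j /= jZ].
  apply/mnm_lepP => j; rewrite mnmE /= gE /v; case: ifP => // _.
  by rewrite galois; have := le_um j; rewrite mnmE.
by rewrite mnmE /= gE /v (negbTE jZ).
Qed.

(** Over a fixed cell, the free coordinates of a corner are prescribed by [psi] and the others are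
    read off from [m]. *)
Lemma corner_inj (x y : corner) m :
  stanley_cell (corner_u x) (corner_Z x) m ->
  stanley_cell (corner_u y) (corner_Z y) m -> (val x).1 = (val y).1 -> x = y.
Proof.
case: x y => [[i g] cg] [[i' h] ch] [_ mg] [_ mh] /= eq_i.
rewrite /corner_u /corner_Z /= in mg mh; move: ch mh; rewrite -{}eq_i => ch mh.
apply/val_inj; congr pair; apply/ffunP => j; apply/val_inj => /=.
move: cg ch => /forallP/(_ j) /= + /forallP/(_ j) /=.
case: ifP => [_ /eqP -> /eqP -> //|/negbT jZ _ _].
by have := mg j jZ; rewrite mh // !mnmE.
Qed.

End Cells.

Lemma sdepth_comap P :
  (sdepth (@monomial_span K n P) <=
   sdepth (@monomial_span K n [set m | P (comap m)]))%N.
Proof.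
apply/bigmax_leqP => d /asboolP[r [u [Z [dec <-]]]].
have [defP disj] := (stanley_decompositionE P u Z).1 dec.
pose Z' (k : 'I_#|corner u Z|) := corner_Z (enum_val k).
(* Every new direction set is one of the old ones, so the minimum cannot drop. *)
apply: (@leq_trans (decomposition_sdepth Z')).
  have := leqnn (decomposition_sdepth Z).
  rewrite !leq_decomposition_sdepth => /andP[-> /forallP leZ] /=.
  by apply/forallP => k; apply: leZ.
apply: (@sdepth_ge _ _ (fun k => corner_u (enum_val k))).
apply/stanley_decompositionE; split=> [m|k l m mk ml].
  rewrite /mkset defP; split=> [[i /comap_cellP[x _ xm]]|[k km]].
    by exists (enum_rank x); rewrite /Z' enum_rankK.
  by exists (val (enum_val k)).1; apply/comap_cellP; exists (enum_val k).
apply/enum_val_inj/(corner_inj mk ml).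
by apply: (disj _ _ (comap m)); apply/comap_cellP;
  [exists (enum_val k) | exists (enum_val l)].
Qed.

End Comap.

End Decompositions.

(** * Monomial regular sequences and the two pullbacks *)

Section CompleteIntersections.
Variables (K : fieldType) (n : nat).
Implicit Types (v : seq 'X_{1..n}) (m : 'X_{1..n}).

Lemma ideal_gen_monomial_seq v :
  ideal_gen [set` @monomials K n v] = monomial_span (multiples [set` v]).
Proof.
rewrite -ideal_gen_monomials; congr ideal_gen.
rewrite eqEsubset; split=> [_ /mapP[m vm ->]|_ [m vm <-]]; first by exists m.
exact: map_f.
Qed.

Lemma regular_monomials_neq0 v m :
  regular_sequence (@monomials K n v) -> m \in v -> m <> 0%MM.
Proof.
move=> [_ proper] vm m0; apply/proper/ideal_gen1.
rewrite ideal_gen_monomial_seq -mpolyX0; apply/monomial_spanX.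
by exists m => //; rewrite m0 lepm_refl.
Qed.

Lemma regular_monomials_disjoint v i j x :
  regular_sequence (@monomials K n v) ->
  (j < i < size v)%N -> minn (nth 0%MM v i x) (nth 0%MM v j x) = 0%N.
Proof.
move=> reg; elim/ltn_ind: i j x => i IHi j x /andP[lt_ji lt_iv].
pose g k := nth 0%MM v k.
have disj k l y : (k < i)%N -> (l < i)%N -> k != l ->
    minn (g k y) (g l y) = 0%N.
  rewrite neq_ltn => ki li /orP[kl|lk]; first rewrite minnC.
    by apply: IHi; rewrite // kl (ltn_trans li).
  by apply: IHi; rewrite // lk (ltn_trans ki).
(* [w = v_j / gcd (v_i, v_j)]: since [v_j] divides [v_i w], regularity puts [w]
   in [(v_0, ..., v_(i-1))], so some [v_k] with [k < i] divides [w]. *)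
pose w : 'X_{1..n} := [multinom g j y - minn (g i y) (g j y) | y < n]%N.
have w_gi y : (g j y <= g i y + w y)%N.
  by rewrite mnmE -leq_subLR; apply: leq_sub2l; apply: geq_minl.
have [_ /(_ i)] := (reg.2, reg.1); rewrite size_map => /(_ lt_iv 'X_[w]).
rewrite (nth_map 0%MM) // -map_take -mpolyXD ideal_gen_monomial_seq.
move=> /(_ _)/monomial_spanX[].
  apply/monomial_spanX; exists (g j).
    by rewrite /= /g -(@nth_take i _ 0%MM j) // mem_nth // size_take lt_iv.
  by apply/mnm_lepP => y; rewrite mnmDE.
move=> _ /(nthP 0%MM)[k + <-]; rewrite size_take lt_iv => lt_ki.
rewrite nth_take // => /mnm_lepP le_w.
(* If [k = j], then [v_j] divides [w], a quotient of [v_j] by the gcd, so the gcd is 1. Otherwise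
   [v_k] divides [v_j] but is disjoint from it by induction, forcing [v_k = 1]. *)
have [eq_kj|ne_kj] := eqVneq k j.
  apply/eqP; rewrite -leqn0 leqNgt; apply/negP => min_gt0.
  move: (le_w x); rewrite eq_kj mnmE leqNgt ltn_subrL min_gt0.
  by rewrite (leq_trans min_gt0) // geq_minr.
case: (@regular_monomials_neq0 v (g k) reg).
  by rewrite mem_nth // (ltn_trans lt_ki).
apply/mnmP => y; rewrite mnm0E -(disj k j y) //; apply/esym/minn_idPl.
by apply: leq_trans (le_w y) _; rewrite mnmE leq_subr.
Qed.

Lemma regular_monomials_eq_exponent v x m m' :
  regular_sequence (@monomials K n v) -> m \in v -> m' \in v ->
  (0 < m x)%N -> (0 < m' x)%N -> m = m'.
Proof.
move=> reg /(nthP 0%MM)[i iv <-] /(nthP 0%MM)[j jv <-] mi mj.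
have min_gt0 : (0 < minn (nth 0%MM v i x) (nth 0%MM v j x))%N.
  by rewrite leq_min mi.
case: (ltngtP i j) => [ij|ji|-> //]; move: min_gt0.
  by rewrite minnC (regular_monomials_disjoint _ reg) ?ltnn ?ij.
by rewrite (regular_monomials_disjoint _ reg) ?ltnn ?ji.
Qed.

(** The left adjoint of multiplication by [N.+1] is division by [N.+1] rounded up. *)
Lemma scale_galois N c x : ((c + N) %/ N.+1 <= x)%N = (c <= x * N.+1)%N.
Proof. by rewrite -ltnS ltn_divLR // mulSn addSn ltnS addnC leq_add2l. Qed.

(** Truncation makes [c = 0] special: every [x] satisfies the right side, so the adjoint is 0 there
    and not [b]. *)
Lemma sub_galois b c x :
  ((if c == 0 then 0 else c + b) <= x)%N = (c <= x - b)%N.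
Proof. by case: c => //= c; rewrite ltn_subRL addSn addnC. Qed.

(** For a regular sequence this is the exponent of [x_j] in the only generator it divides, or 0 if
    there is none. *)
Definition max_exponent v (j : 'I_n) : nat := \max_(m <- v) m j.

Lemma leq_max_exponent v m j : m \in v -> (m j <= max_exponent v j)%N.
Proof.
move=> vm.
exact: (@leq_bigmax_seq _ v xpredT (fun g : 'X_{1..n} => g j)).
Qed.

Lemma regular_max_exponent v g j : regular_sequence (@monomials K n v) ->
  g \in v -> (0 < g j)%N -> max_exponent v j = g j.
Proof.
move=> reg vg gj; apply/eqP; rewrite eqn_leq leq_max_exponent // andbT.
apply/bigmax_leqP_seq => h vh _; have [->//|hj] := posnP (h j).
by rewrite (regular_monomials_eq_exponent reg vh vg hj gj).
Qed.

(** The exponents of the ideal generated by the squarefree parts of the generators, which is the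
    radical. *)
Definition support_multiples v : set 'X_{1..n} :=
  [set m | exists2 g, g \in v & forall j, (0 < g j)%N -> (0 < m j)%N].

(** Scaling keeps zero coordinates zero and lifts positive ones to at least [N.+1], hence above
    every exponent of a generator. *)
Lemma multiples_scale v N m :
  (forall j, max_exponent v j <= N.+1)%N ->
  multiples [set` v] (comap (fun _ x => x * N.+1)%N m) <->
  support_multiples v m.
Proof.
move=> leN; split=> -[g vg gm]; exists g => //.
  move=> j gj; have := mnm_lepP gm j; rewrite mnmE.
  by case: (m j) => [|//]; rewrite mul0n leqNgt gj.
apply/mnm_lepP => j; rewrite mnmE.
have [gj|gj] := posnP (g j); first by rewrite gj.
apply: leq_trans (leq_max_exponent j vg) _; apply: leq_trans (leN j) _.
by rewrite leq_pmull // gm.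
Qed.

Lemma radical_multiples v :
  radical (@monomial_span K n (multiples [set` v])) =
  monomial_span (support_multiples v).
Proof.
rewrite radical_monomial_span; last exact: upward_closed_multiples.
congr monomial_span; rewrite eqEsubset; split=> m.
  move=> [k [g vg /mnm_lepP gm]]; exists g => // j gj.
  by have := leq_trans gj (gm j); rewrite mulmnE muln_gt0 => /andP[].
move=> sm; exists (\max_j max_exponent v j).
have -> : (m *+ (\max_j max_exponent v j).+1)%MM =
          comap (fun _ x => x * (\max_j max_exponent v j).+1)%N m.
  by apply/mnmP => j; rewrite mulmnE mnmE.
by apply/multiples_scale => // j; apply/leqW/leq_bigmax.
Qed.

(** For [a > 0], [x - (a - 1)] is positive exactly when [a <= x]. Regularity ensures that [a] is the
    exponent in the generator at hand, whichever it is. *)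
Lemma support_multiples_sub v m : regular_sequence (@monomials K n v) ->
  support_multiples v (comap (fun j x => x - (max_exponent v j).-1)%N m) <->
  multiples [set` v] m.
Proof.
move=> reg; split=> -[g vg gm]; exists g => //.
  apply/mnm_lepP => j; have [->//|gj] := posnP (g j).
  have := gm j gj; rewrite mnmE (regular_max_exponent reg vg gj) subn_gt0.
  by rewrite prednK.
move=> j gj; rewrite mnmE (regular_max_exponent reg vg gj) subn_gt0 prednK //.
exact: (mnm_lepP gm).
Qed.

End CompleteIntersections.

Theorem theorem2p1 (K : fieldType) (n : nat) (I : set {mpoly K[n]})
    (hI : complete_intersection_monomial_ideal I) :
  sdepth I = sdepth (radical I).
Proof.
case: hI => _ _ _ [v [[-> _] reg]].
rewrite ideal_gen_monomial_seq radical_multiples; apply/eqP; rewrite eqn_leq.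
apply/andP; split.
  (* Pulling back along scaling by [N.+1] turns [I] into its radical. *)
  pose N := \max_j max_exponent v j.
  have := sdepth_comap K (fun _ => scale_galois N) (multiples [set` v]).
  congr (_ <= sdepth (monomial_span _))%N; apply/seteqP.
  by split=> m /multiples_scale; apply=> j; apply/leqW/leq_bigmax.
(* Pulling back along the truncated subtraction turns the radical into [I]. *)
have := sdepth_comap K (fun j => sub_galois (max_exponent v j).-1)
  (support_multiples v).
congr (_ <= sdepth (monomial_span _))%N; apply/seteqP.
by split=> m /(support_multiples_sub m reg).
Qed.
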